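(* Let $q$ be a prime power, $2\le n\le m$ integers, $\mathcal{C}\le\mathbb{F}_q^{n\times m}$ an $\mathbb{F}_q$-linear subspace of dimension $k$, and $0\le i\le k$. For all $0\le\tau\le m-1$, as formal power series in $T$ over $\mathbb{Q}$, $$Z_\mathcal{C}^{(i)}(T)=Z_\tau^{(i)}(T)\sum_{u\ge0}\beta_{\tau,u}^{(i)}(\mathcal{C})T^u,$$ where $$\beta_{\tau,u}^{(i)}(\mathcal{C}):=\sum_{j=0}^u\frac{p_j^{(i)}(\mathcal{C})}{\left(p_{\tau,0}^{(i)}\right)^{u-j+1}}\,\mathcal{P}_{u-j}\left(p_{\tau,0}^{(i)},-p_{\tau,1}^{(i)},-p_{\tau,2}^{(i)},\ldots,-p_{\tau,u-j}^{(i)}\right).$$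
   Context: The dual is $\mathcal{C}^\perp=\{N\in\mathbb{F}_q^{n\times m}:\operatorname{Tr}(MN^t)=0\ \forall M\in\mathcal{C}\}$; $d^\perp$ is the minimum rank of a nonzero element of $\mathcal{C}^\perp$, and $d^\perp=n+1$ if $\mathcal{C}^\perp=\{0\}$. An optimal anticode is a subspace $A\le\mathbb{F}_q^{n\times m}$ with $\dim A=m\cdot\max\{\operatorname{rk}(M):M\in A\}$, and $d_i=\frac1m\min\{\dim A: A\text{ an optimal anticode},\ \dim(A\cap\mathcal{C})\ge i\}$. For integers $a,b$ and a prime power $Q$, $\begin{bmatrix} a \\ b \end{bmatrix}_Q$ is $0$ if $b<0$ or $0\le a<b$; $1$ if $b=0$; $\prod_{s=1}^b\frac{Q^{a-s+1}-1}{Q^s-1}$ if $b>0$, $a\ge b$; $(-1)^bQ^{ab-\binom b2}\begin{bmatrix} -a+b-1 \\ b \end{bmatrix}_Q$ if $b>0$, $a<0$. For $U\le\mathbb{F}_q^n$ let $\mathcal{C}(U)$ (respectively, if $n=m$, $\mathcal{C}[U]$) be the set of $M\in\mathcal{C}$ with column space (respectively row space) contained in $U$. For $0\le u\le n$, $B_u^{(i)}(\mathcal{C})=\sum_{\dim U=u}\begin{bmatrix} \dim\mathcal{C}(U) \\ i \end{bmatrix}_q$ if $n<m$, and $B_u^{(i)}(\mathcal{C})=\frac12\sum_{\dim U=u}\Big(\begin{bmatrix} \dim\mathcal{C}(U) \\ i \end{bmatrix}_q+\begin{bmatrix} \dim\mathcal{C}[U] \\ i \end{bmatrix}_q\Big)$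 if $n=m$ (sums over $U\le\mathbb{F}_q^n$). For integers $u$: $b_u^{(i)}(\mathcal{C})=0$ if $u<0$; $b_u^{(i)}(\mathcal{C})=B_{u+d_i}^{(i)}(\mathcal{C})\big/\begin{bmatrix} n \\ u+d_i \end{bmatrix}_q$ if $0\le u\le n-d^\perp-d_i$; $b_u^{(i)}(\mathcal{C})=\begin{bmatrix} k-m(n-u-d_i) \\ i \end{bmatrix}_q$ if $u\ge0$ and $u>n-d^\perp-d_i$. Set $Z_\mathcal{C}^{(i)}(T)=\sum_{u\ge0}b_u^{(i)}(\mathcal{C})T^u$ and, for $u\ge0$, $p_u^{(i)}(\mathcal{C})=\sum_{j=0}^{i+1}\begin{bmatrix} i+1 \\ j \end{bmatrix}_{q^m}(-1)^jq^{m\binom j2}b_{u-j}^{(i)}(\mathcal{C})$, i.e. the coefficient of $T^u$ in $Z_\mathcal{C}^{(i)}(T)\prod_{j=0}^i(1-q^{mj}T)$. For $0\le\tau\le m-1$: $b_{\tau,u}^{(i)}=\begin{bmatrix} \tau+m\left(u-\lfloor\frac{\tau-i}{m}\rfloor\right) \\ i \end{bmatrix}_q$ for $u\ge0$ and $b_{\tau,u}^{(i)}=0$ for $u<0$; $Z_\tau^{(i)}(T)=\sum_{u\ge0}b_{\tau,u}^{(i)}T^u$; $p_{\tau,u}^{(i)}=\sum_{t=0}^{i+1}\begin{bmatrix} i+1 \\ t \end{bmatrix}_{q^m}(-1)^tq^{m\binom t2}b_{\tau,u-t}^{(i)}$ for $u\ge 0$. Homogeneous ordinary Bell polynomials: for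 $0\le b\le a$, $\mathcal{P}_{a,b}(x_0,x_1,\dots,x_{a-b+1})$ is the coefficient of $X^a$ in $\left(\sum_{j\ge1}x_jx_0^{j-1}X^j\right)^b$ (so $\mathcal{P}_{0,0}=1$, $\mathcal{P}_{a,0}=0$ for $a\ge1$), and $\mathcal{P}_a(x_0,x_1,\dots,x_a)=\sum_{b=0}^a\mathcal{P}_{a,b}(x_0,\dots,x_{a-b+1})$. *)

(* Defs.v *)
From HB Require Import structures.
From mathcomp Require Import all_boot all_order all_algebra.

Set Implicit Arguments.
Unset Strict Implicit.
Unset Printing Implicit Defensive.

Import Order.TTheory GRing.Theory Num.Theory.
Local Open Scope ring_scope.

(* A vector space over a finite field has finitely many subspaces; this gives
   meaning to sums and minima over {vspace vT} below. *)
HB.instance Definition _ (F : finFieldType) (vT : vectType F) :=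
  CanIsCountable (@VectorInternalTheory.vs2mxK F vT).
HB.instance Definition _ (F : finFieldType) (vT : vectType F) :
    isFinite {vspace vT} :=
  CanIsFinite (@VectorInternalTheory.vs2mxK F vT).

(* Gaussian binomials with integer arguments. *)

Definition qbin_prod (Q : rat) (a b : int) : rat :=
  \prod_(1 <= s < `|b|%N.+1) ((Q ^ (a - s%:Z + 1) - 1) / (Q ^ s%:Z - 1)).

(* When 0 < b and a < 0, the top argument - a + b - 1 is at least b, so the
   Gaussian binomial it refers to is again given by the product. *)
Definition qbin (Q : rat) (a b : int) : rat :=
  if (b < 0) || (0 <= a < b) then 0
  else if b == 0 then 1
  else if b <= a then qbin_prod Q a b
  else (-1) ^ b * Q ^ (a * b - 'C(`|b|%N, 2)%:Z) * qbin_prod Q (- a + b - 1) b.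

(* Formal power series over rat, as coefficient sequences; equality is =1. *)

Definition fps := nat -> rat.

Definition fps_one : fps := fun u => (u == 0%N)%:R.

Definition fps_mul (f g : fps) : fps :=
  fun u => \sum_(j < u.+1) f j * g (u - j)%N.

Definition fps_exp (f : fps) (b : nat) : fps := iter b (fps_mul f) fps_one.

(* The arguments x_0, x_1, ... are given as an infinite sequence, but
   bell_part a b x only depends on its first a - b + 2 terms. *)
Definition bell_part (a b : nat) (x : nat -> rat) : rat :=
  fps_exp (fun j => if j == 0%N then 0 else x j * x 0%N ^+ j.-1) b a.

Definition bell (a : nat) (x : nat -> rat) : rat :=
  \sum_(b < a.+1) bell_part a b x.

Section Codes.

Variables (F : finFieldType) (n m : nat).
Implicit Types (C A : {vspace 'M[F]_(n, m)}) (M N : 'M[F]_(n, m)).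

Definition dual C : {set 'M[F]_(n, m)} :=
  [set N | [forall (M | M \in C), \tr (M *m N^T) == 0]].

(* Ranks are at most n, so n + 1 is returned exactly when the dual is zero. *)
Definition dual_distance C : nat :=
  \big[minn/n.+1]_(N in dual C | N != 0) \rank N.

Definition optimal_anticode A : bool :=
  \dim A == (m * \max_(M in A) \rank M)%N.

(* For n <= m and i <= \dim C the whole matrix space, of dimension n * m, is
   among the anticodes considered, so the default value is harmless. The
   division is exact because m divides \dim A. *)
Definition gen_weight C (i : nat) : nat :=
  ((\big[minn/(n * m)%N]_(A : {vspace 'M[F]_(n, m)} |
      optimal_anticode A && (i <= \dim (A :&: C))%N) \dim A) %/ m)%N.

Definition colspace M : {vspace 'cV[F]_n} := (\sum_(j < m) <[col j M]>)%VS.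
Definition rowspace M : {vspace 'rV[F]_m} := (\sum_(i < n) <[row i M]>)%VS.

(* C(U) and C[U]; see memv_col_short and memv_row_short. *)
Definition col_short C (U : {vspace 'cV[F]_n}) : {vspace 'M[F]_(n, m)} :=
  (C :&: \bigcap_(j < m) (linfun (col j) @^-1: U))%VS.
Definition row_short C (U : {vspace 'rV[F]_m}) : {vspace 'M[F]_(n, m)} :=
  (C :&: \bigcap_(i < n) (linfun (row i) @^-1: U))%VS.

Lemma memv_col_short C (U : {vspace 'cV[F]_n}) M :
  (M \in col_short C U) = (M \in C) && (colspace M <= U)%VS.
Proof.
rewrite memv_cap; congr (_ && _); rewrite memvE.
by apply/subv_bigcapP/subv_sumP => H j _; move: (H j isT);
  rewrite -!memvE -memv_preim lfunE.
Qed.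

Lemma memv_row_short C (U : {vspace 'rV[F]_m}) M :
  (M \in row_short C U) = (M \in C) && (rowspace M <= U)%VS.
Proof.
rewrite memv_cap; congr (_ && _); rewrite memvE.
by apply/subv_bigcapP/subv_sumP => H j _; move: (H j isT);
  rewrite -!memvE -memv_preim lfunE.
Qed.

Definition field_q : rat := #|F|%:R.
Local Notation q := field_q.

(* The space F^n containing U is 'cV_n for column spaces; for row spaces, which
   only occur when n = m, it is 'rV_m. This is why the sum over U is split. Only
   n <= m is intended, so that the last case is n = m. *)
Definition code_B (C : {vspace 'M[F]_(n, m)}) (i u : nat) : rat :=
  if (n < m)%N then
    \sum_(U : {vspace 'cV[F]_n} | \dim U == u)
       qbin q (\dim (col_short C U))%:Z i%:Z
  else
    2^-1 * (\sum_(U : {vspace 'cV[F]_n} | \dim U == u)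
              qbin q (\dim (col_short C U))%:Z i%:Z
            + \sum_(U : {vspace 'rV[F]_m} | \dim U == u)
                qbin q (\dim (row_short C U))%:Z i%:Z).

Definition code_b (C : {vspace 'M[F]_(n, m)}) (i : nat) (u : int) : rat :=
  let d := gen_weight C i in
  if u < 0 then 0
  else if u <= n%:Z - (dual_distance C)%:Z - d%:Z then
    code_B C i (`|u| + d)%N / qbin q n%:Z (u + d%:Z)
  else qbin q ((\dim C)%:Z - m%:Z * (n%:Z - u - d%:Z)) i%:Z.

Definition code_Z C (i : nat) : fps := fun u => code_b C i u%:Z.

Definition code_p C (i u : nat) : rat :=
  \sum_(0 <= j < i.+2)
    qbin (q ^+ m) i.+1%:Z j%:Z * (-1) ^+ j * q ^+ (m * 'C(j, 2))
    * code_b C i (u%:Z - j%:Z).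

End Codes.

Section Tau.

Variables (F : finFieldType) (m : nat).
Local Notation q := (field_q F).

(* For m > 0, integer division (_ %/ m)%Z is the floor of the quotient. *)
Definition tau_b (tau i : nat) (u : int) : rat :=
  if u < 0 then 0
  else qbin q (tau%:Z + m%:Z * (u - ((tau%:Z - i%:Z) %/ m%:Z)%Z)) i%:Z.

Definition tau_Z (tau i : nat) : fps := fun u => tau_b tau i u%:Z.

Definition tau_p (tau i u : nat) : rat :=
  \sum_(0 <= t < i.+2)
    qbin (q ^+ m) i.+1%:Z t%:Z * (-1) ^+ t * q ^+ (m * 'C(t, 2))
    * tau_b tau i (u%:Z - t%:Z).

End Tau.

Definition beta (F : finFieldType) (n m : nat) (C : {vspace 'M[F]_(n, m)})
    (tau i u : nat) : rat :=
  \sum_(0 <= j < u.+1)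
    code_p C i j / tau_p F m tau i 0 ^+ (u - j).+1
    * bell (u - j) (fun t => if t == 0%N then tau_p F m tau i 0
                             else - tau_p F m tau i t).

(* Main.v *)
Require Import Defs.
From mathcomp Require Import all_boot all_order all_algebra.
From mathcomp Require Import ring.

(** Writing [E] for the series [\prod_(j <= i) (1 - q^(m j) T)], expanded as in
    [denominator] by the q-binomial theorem, one has [p_C = E * Z_C] and
    [p_tau = E * Z_tau]. With [p] for [p_tau], the Bell polynomials expand the
    geometric series of [1 - p(p_0 X) / p_0], so that
    [\sum_a bell a / p_0^(a+1) T^a] is the inverse of [p_tau], whose constant
    term is nonzero. Hence [beta = p_C / p_tau] and
    [Z_tau * beta = Z_tau * E * Z_C / (E * Z_tau) = Z_C]. *)

Import Order.TTheory GRing.Theory Num.Theory.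
Local Open Scope ring_scope.

(** A coefficient of a product involves only coefficients of at most the same index, so identities
    between series can be checked on truncations, where [{poly rat}] offers its ring structure. *)
Definition agree_upto (u : nat) (f : fps) (p : {poly rat}) : Prop :=
  forall k, (k <= u)%N -> f k = p`_k.

Lemma agree_upto_poly u (f : fps) : agree_upto u f (\poly_(j < u.+1) f j).
Proof. by move=> k le_ku; rewrite coef_poly ltnS le_ku. Qed.

Lemma agree_upto_mul {u} {f g : fps} {p r : {poly rat}} :
  agree_upto u f p -> agree_upto u g r -> agree_upto u (fps_mul f g) (p * r).
Proof.
move=> fp gr k le_ku; rewrite /fps_mul coefM; apply: eq_bigr => j _.
rewrite fp ?gr //; first exact: leq_trans (leq_subr _ _) le_ku.
by apply: leq_trans le_ku; rewrite -ltnS.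
Qed.

Lemma fps_mul_exchange (e f g h : fps) :
  fps_mul f (fps_mul (fps_mul e g) h) =1 fps_mul g (fps_mul (fps_mul e f) h).
Proof.
move=> u; have [ep fp] := (@agree_upto_poly u e, @agree_upto_poly u f).
have [gp hp] := (@agree_upto_poly u g, @agree_upto_poly u h).
rewrite (agree_upto_mul fp (agree_upto_mul (agree_upto_mul ep gp) hp)) //.
rewrite (agree_upto_mul gp (agree_upto_mul (agree_upto_mul ep fp) hp)) //.
by congr nth; congr polyseq; ring.
Qed.

Lemma eq_fps_mul {f f' g g' : fps} :
  f =1 f' -> g =1 g' -> fps_mul f g =1 fps_mul f' g'.
Proof. by move=> ff' gg' u; apply: eq_bigr => j _; rewrite ff' gg'. Qed.

Lemma fps_mulr1 (f : fps) : fps_mul f fps_one =1 f.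
Proof.
move=> u; rewrite /fps_mul big_ord_recr /= subnn mulr1 big1 ?add0r // => j _.
by rewrite /fps_one subn_eq0 leqNgt ltn_ord mulr0.
Qed.

Lemma fps_exp_lt (g : fps) b a : g 0%N = 0 -> (a < b)%N -> fps_exp g b a = 0.
Proof.
move=> g0; elim: b a => // b IHb a lt_ab.
rewrite /fps_exp iterS; apply: big1 => -[[|j] lt_ja] _ /=; first by rewrite g0 mul0r.
rewrite [iter _ _ _ _]IHb ?mulr0 //.
by rewrite ltn_subLR // (leq_trans (lt_ab : a.+1 <= b.+1)%N) // addSn ltnS leq_addl.
Qed.

(** This is the coefficient of X^(a+1) in S = 1 + g S for the geometric series S of g. Each
    coefficient of S is a finite sum because g^b starts in degree b or later. *)
Lemma fps_geometric_rec (g : fps) a : g 0%N = 0 ->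
  \sum_(b < a.+2) fps_exp g b a.+1
  = \sum_(j < a.+1) g j.+1 * \sum_(b < (a - j).+1) fps_exp g b (a - j)%N.
Proof.
move=> g0; rewrite big_ord_recl /= /fps_one add0r.
under eq_bigr => b _ do rewrite /fps_mul big_ord_recl g0 mul0r add0r.
rewrite exchange_big /=; apply: eq_bigr => j _; rewrite -mulr_sumr; congr (_ * _).
rewrite /bump add1n subSS.
rewrite -!(big_mkord xpredT (fun b => fps_exp g b (a - j)%N)).
(* The powers with b > a - j contribute nothing in degree a - j. *)
rewrite [LHS](@big_cat_nat _ _ _ (a - j).+1) ?ltnS ?leq_subr //=.
rewrite [X in _ + X]big_nat_cond [X in _ + X]big1 ?addr0 // => b.
by rewrite andbT => /andP[lt_b _]; rewrite fps_exp_lt.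
Qed.

Lemma fps_mul_bell (p : fps) : p 0%N != 0 ->
  fps_mul p (fun a => bell a (fun t => if t == 0%N then p 0%N else - p t)
                      / p 0%N ^+ a.+1) =1 fps_one.
Proof.
move=> p0 [|a]; rewrite /fps_mul big_ord_recl /=.
  by rewrite big_ord0 /bell big_ord1 /bell_part /fps_exp /= expr1 addr0 mul1r divff.
set x : nat -> rat := fun t => _.
have -> : bell a.+1 x = \sum_(j < a.+1) (- p j.+1 * p 0%N ^+ j) * bell (a - j) x.
  by rewrite /bell /bell_part fps_geometric_rec.
(* The leading term is now [bell a.+1 x] over p_0^(a+1); expanded by the recurrence, it cancels the
   remaining terms one by one. *)
rewrite exprS invfM mulrCA [p _ * _]mulrA divff // mul1r mulr_suml.
rewrite -big_split big1 // => j _ /=; rewrite /bump add1n subSS.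
have -> : p 0%N ^+ a.+1 = p 0%N ^+ j * p 0%N ^+ (a - j).+1.
  by rewrite -exprD addnS subnKC // -ltnS.
by field; rewrite !expf_neq0.
Qed.

(** Padding both sums with zeros to the length [maxn N u.+1] makes them equal: [e] vanishes from N
    on, and [b] vanishes at u - j once j > u. *)
Lemma sum_int_fps_mul (e : fps) (b : int -> rat) N u :
  (forall j, (N <= j)%N -> e j = 0) -> (forall z, z < 0 -> b z = 0) ->
  \sum_(0 <= j < N) e j * b (u%:Z - j%:Z) = fps_mul e (fun v => b v%:Z) u.
Proof.
move=> e0 b0; pose G j := e j * b (u%:Z - j%:Z).
have GN j : (N <= j)%N -> G j = 0 by move=> le_Nj; rewrite /G e0 ?mul0r.
have Gu j : (u < j)%N -> G j = 0.
  by move=> lt_uj; rewrite /G b0 ?mulr0 // subr_lt0 ltz_nat.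
have pad M K : (M <= K)%N -> (forall j, (M <= j)%N -> G j = 0) ->
    \sum_(0 <= j < M) G j = \sum_(0 <= j < K) G j.
  move=> le_MK G0; rewrite [RHS](@big_cat_nat _ _ _ M) //=.
  rewrite [X in _ + X]big_nat_cond [X in _ + X]big1 ?addr0 // => j.
  by rewrite andbT => /andP[/G0].
rewrite (pad N (maxn N u.+1)) ?leq_maxl //.
rewrite -(pad u.+1 (maxn N u.+1)) ?leq_maxr // big_mkord.
by apply: eq_bigr => j _; rewrite /G subzn // -ltnS.
Qed.

Lemma qbin_neq0 (Q : rat) (a b : int) :
  1 < Q -> 0 <= b -> b <= a -> qbin Q a b != 0.
Proof.
move=> Q1 b0 ba; rewrite /qbin ltNge b0 [a < b]ltNge ba andbF /=.
case: (b =P 0) => // _; have expQ (z : int) : 0 < z -> Q ^ z - 1 != 0.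
  case: z => // -[|z] // _; rewrite subr_eq0 gt_eqF //.
  exact: (exprn_egt1 z.+1 Q1).
rewrite /qbin_prod big_nat_cond; elim/big_ind: _ => [|x y|s]; first exact: oner_neq0.
  exact: mulf_neq0.
rewrite andbT => /andP[s1 sb].
rewrite mulf_neq0 ?invr_neq0 ?expQ ?ltz_nat //.
(* The exponent a - s + 1 is positive because s <= b <= a. *)
rewrite ltzD1 subr_ge0; apply: le_trans ba.
by rewrite -(gez0_abs b0) lez_nat -ltnS.
Qed.

Lemma field_q_gt1 (F : finFieldType) : 1 < field_q F.
Proof. by rewrite /field_q ltr1n; exact: card_finNzRing_gt1. Qed.

Definition denominator (F : finFieldType) (m i : nat) : fps := fun j =>
  qbin (field_q F ^+ m) i.+1%:Z j%:Z * (-1) ^+ j * field_q F ^+ (m * 'C(j, 2)).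

Lemma denominator_gt (F : finFieldType) m i j :
  (i.+2 <= j)%N -> denominator F m i j = 0.
Proof. by move=> lt_ij; rewrite /denominator /qbin /= ltz_nat lt_ij !mul0r. Qed.

Lemma code_pE (F : finFieldType) n m (C : {vspace 'M[F]_(n, m)}) i :
  code_p C i =1 fps_mul (denominator F m i) (code_Z C i).
Proof.
move=> u; apply: (@sum_int_fps_mul _ (code_b C i)); first exact: denominator_gt.
by move=> z z0; rewrite /code_b z0.
Qed.

Lemma tau_pE (F : finFieldType) m tau i :
  tau_p F m tau i =1 fps_mul (denominator F m i) (tau_Z F m tau i).
Proof.
move=> u; apply: (@sum_int_fps_mul _ (tau_b F m tau i)); first exact: denominator_gt.
by move=> z z0; rewrite /tau_b z0.
Qed.

(** Only t = 0 contributes, leaving a q-binomial with top tau - m * floor((tau - i) / m). This is at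
    least i by the definition of the floor. *)
Lemma tau_p0_neq0 (F : finFieldType) m tau i :
  (0 < m)%N -> tau_p F m tau i 0 != 0.
Proof.
move=> m0; rewrite tau_pE /fps_mul big_ord1 /denominator /=.
rewrite [qbin _ _ 0%:Z]/qbin /= mul1r mul1r muln0 expr0 mul1r.
apply: qbin_neq0; rewrite ?field_q_gt1 // sub0r mulrN lerBrDl addrC -lerBrDl.
by rewrite mulrC lez_floor // -lt0n.
Qed.

Theorem theorem6p6 (F : finFieldType) (n m : nat) (hn : (2 <= n)%N)
    (hnm : (n <= m)%N) (C : {vspace 'M[F]_(n, m)}) (i : nat)
    (hi : (i <= \dim C)%N) (tau : nat) (htau : (tau <= m - 1)%N) :
  code_Z C i =1 fps_mul (tau_Z F m tau i) (beta C tau i).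
Proof.
have m0 : (0 < m)%N by apply: leq_trans hnm; apply: leq_trans hn.
pose p := tau_p F m tau i.
pose pV : fps := fun a =>
  bell a (fun t => if t == 0%N then p 0%N else - p t) / p 0%N ^+ a.+1.
have betaE : beta C tau i =1 fps_mul (fps_mul (denominator F m i) (code_Z C i)) pV.
  move=> u; rewrite /beta big_mkord; apply: eq_bigr => j _.
  by rewrite -code_pE mulrAC mulrA.
have pVE : fps_mul (fps_mul (denominator F m i) (tau_Z F m tau i)) pV =1 fps_one.
  move=> u; rewrite -(fps_mul_bell _ (tau_p0_neq0 F m tau i m0)).
  by apply: eq_fps_mul => // v; rewrite tau_pE.
(* The exchange puts [tau_Z] in place of [code_Z] next to [denominator], which turns the inner
   factor into p times its inverse [pV]. *)
move=> u; rewrite (eq_fps_mul (frefl _) betaE) fps_mul_exchange.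
by rewrite (eq_fps_mul (frefl _) pVE) fps_mulr1.
Qed.
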